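(* Let $(\mathfrak{g},\omega)$ be a symplectic Novikov Lie algebra (SNLA). Then the Lie algebra $\mathfrak{g}$ is two-step solvable, i.e. $[[x,y],[z,t]]=0$ for all $x,y,z,t\in\mathfrak{g}$.
   Context: A symplectic Lie algebra $(\mathfrak{g},\omega)$ is a finite-dimensional real Lie algebra $\mathfrak{g}$ with a skew-symmetric non-degenerate bilinear form $\omega$ such that $\omega([x,y],z)+\omega([y,z],x)+\omega([z,x],y)=0$ for all $x,y,z\in\mathfrak{g}$. The left-symmetric product associated with $(\mathfrak{g},\omega)$ is the bilinear product defined by $\omega(x.y,z)=-\omega(y,[x,z])$ for all $x,y,z\in\mathfrak{g}$; it is known to be left-symmetric and to satisfy $x.y-y.x=[x,y]$. $(\mathfrak{g},\omega)$ is called a symplectic Novikov Lie algebra (SNLA) if this product is Novikov, i.e. $(x.y).z=(x.z).y$ for all $x,y,z\in\mathfrak{g}$. *)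

(* Defs.v *)
From HB Require Import structures.
From mathcomp Require Export all_boot all_order all_algebra.
From mathcomp Require Export reals.

Set Implicit Arguments.
Unset Strict Implicit.
Unset Printing Implicit Defensive.

Import GRing.Theory.
Local Open Scope ring_scope.

Section Definitions.
Variables (R : realType) (g : vectType R).
Implicit Types (br : {bilinear g -> g -> g}) (w : {skew_symmetric g}).

Definition lie_bracket br : Prop :=
  (forall x, br x x = 0) /\
  (forall x y z, br x (br y z) + br y (br z x) + br z (br x y) = 0).

Definition symplectic_lie_algebra br w : Prop :=
  [/\ lie_bracket br,
      nondegenerate w &
      forall x y z, w (br x y) z + w (br y z) x + w (br z x) y = 0].

Definition flat w : 'Hom(g, 'Hom(g, R^o)) :=
  linfun (fun u => linfun (w u : g -> R^o)).

(* The left-symmetric product x.y: the vector representing the linear form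
   z |-> - w(y, [x, z]) through w, see lsprodE and lsprod_unique.  If w is
   degenerate, (flat w)^-1 is only a partial inverse and lsprod br w need not
   satisfy lsprodE. *)
Definition lsprod br w (x y : g) : g :=
  ((flat w)^-1)%VF (linfun (fun z => - w y (br x z) : R^o)).

Definition novikov (p : g -> g -> g) : Prop :=
  forall x y z, p (p x y) z = p (p x z) y.

Definition SNLA br w : Prop :=
  symplectic_lie_algebra br w /\ novikov (lsprod br w).

End Definitions.

Section Characterization.
Variables (R : realType) (g : vectType R).
Variables (br : {bilinear g -> g -> g}) (w : {skew_symmetric g}).

Lemma linfunE_of_linear (V W : vectType R) (f : V -> W) :
  linear f -> linfun f =1 f.
Proof.
move=> f_lin.
pose fL := GRing.isLinear.Build R V W *:%R f f_lin.
pose F : {linear V -> W} := HB.pack f fL.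
exact: (lfunE F).
Qed.

Lemma flatE u v : flat w u v = w u v.
Proof.
have w_lin t : linear (w t : g -> R^o) by move=> a x y; rewrite linearPr.
rewrite /flat linfunE_of_linear ?linfunE_of_linear //.
move=> a x y; apply/lfunP => z.
by rewrite add_lfunE scale_lfunE !linfunE_of_linear // linearPl.
Qed.

Lemma nondegenerateP :
  reflect (forall x, (forall y, w x y = 0) -> x = 0) (nondegenerate w).
Proof.
apply: (iffP eqP) => [radw0 x wx0 | w_inj].
  by apply/eqP; rewrite -memv0 -radw0; apply/mem_orthovP => y _.
apply/eqP; rewrite -subv0; apply/subvP => x /mem_orthovP wx0.
by rewrite memv0; apply/eqP/w_inj => y; rewrite wx0 ?memvf.
Qed.

Hypothesis w_nondeg : nondegenerate w.

Lemma nondegenerate_inj u v : (forall z, w u z = w v z) -> u = v.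
Proof.
move=> uv; apply/eqP; rewrite -subr_eq0; apply/eqP.
apply: (nondegenerateP w_nondeg) => z; rewrite linearBl.
by apply/eqP; rewrite subr_eq0; apply/eqP/uv.
Qed.

Lemma lsprodE x y z : w (lsprod br w x y) z = - w y (br x z).
Proof.
have flat_inj : lker (flat w) == 0%VS.
  apply/lker0P => u v /lfunP uv; apply: nondegenerate_inj => t.
  by rewrite -!flatE uv.
have flat_surj : limg (flat w) = fullv.
  apply/eqP; rewrite eqEdim subvf limg_dim_eq ?(eqP flat_inj) ?capv0 //.
  by rewrite !dimvf /dim /= muln1.
rewrite -flatE /lsprod limg_lfunVK ?flat_surj ?memvf //.
rewrite linfunE_of_linear // => a u v.
by rewrite !linearPr opprD scalerN.
Qed.

Lemma lsprod_unique (p : g -> g -> g) :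
  (forall x y z, w (p x y) z = - w y (br x z)) -> p =2 lsprod br w.
Proof.
by move=> pE x y; apply: nondegenerate_inj => z; rewrite pE lsprodE.
Qed.

End Characterization.

(* Main.v *)
(** The product satisfies [x.y - y.x = [x,y]] and left symmetry, and each right
    multiplication is self-adjoint for [w].  Taking the adjoint of the Novikov
    identity [(x.y).z = (x.z).y] therefore gives [[x.y, u] = [x, u.y]]; compared
    with left symmetry this says that the associator [(x,u,y)] is its own
    opposite, so the product is associative.  Then
    [x.(y.z) = (x.y).z = (x.z).y = x.(z.y)], that is [x.[y,z] = 0], and
    [[a,b],[c,d]] = [a,b].[c,d] - [c,d].[a,b] = 0. *)
Require Import Defs.
From mathcomp Require Import lra.
Import GRing.Theory Num.Theory.
Local Open Scope ring_scope.

Lemma subr_interchange (V : zmodType) (a b c d : V) :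
  a - b = c - d -> a - c = b - d.
Proof.
move/eqP; rewrite subr_eq => /eqP ->.
by rewrite addrAC [c - d - c]addrAC subrr sub0r addrC.
Qed.

Section LeftSymmetricProduct.
Variables (R : realType) (g : vectType R).
Variables (br : {bilinear g -> g -> g}) (w : {skew_symmetric g}).
Hypothesis br_w_symplectic : symplectic_lie_algebra br w.

Local Notation "x ** y" := (lsprod br w x y) (at level 40, left associativity).

Let w_nondeg : nondegenerate w.
Proof. by case: br_w_symplectic. Qed.

Lemma skew_symmetricC x y : w x y = - w y x.
Proof. by rewrite (@hermC R true idfun g w) expr1 mulN1r. Qed.

Lemma lie_bracketC x y : br x y = - br y x.
Proof.
have [[br_alt _] _ _] := br_w_symplectic.
apply/eqP; rewrite -addr_eq0; apply/eqP.
have := br_alt (x + y).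
by rewrite linearDl !linearDr !br_alt addr0 add0r.
Qed.

Lemma lsprodBl x y z : (x - y) ** z = x ** z - y ** z.
Proof.
apply: (nondegenerate_inj w_nondeg) => u.
by rewrite lsprodE // !linearBl linearBr /= !lsprodE // opprB opprK addrC.
Qed.

Lemma lsprodBr x y z : x ** (y - z) = x ** y - x ** z.
Proof.
apply: (nondegenerate_inj w_nondeg) => u.
by rewrite lsprodE // !linearBl /= !lsprodE // opprB opprK addrC.
Qed.

(** Pairing with [z] under [w] turns this into the closedness of [w]. *)
Lemma lsprod_commutator x y : x ** y - y ** x = br x y.
Proof.
have [_ _ w_closed] := br_w_symplectic.
apply: (nondegenerate_inj w_nondeg) => z.
rewrite linearBl /= !lsprodE // opprK.
have := w_closed x y z.
rewrite (skew_symmetricC (br y z)) (skew_symmetricC (br z x)).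
rewrite (lie_bracketC z x) linearNr opprK => E; lra.
Qed.

(** Both sides equal [- w x (br y z)]: the signs from the skew-symmetry of [w] and of the bracket
    cancel. *)
Lemma lsprod_selfadjoint x y z : w (y ** x) z = w y (z ** x).
Proof.
by rewrite (skew_symmetricC y) !lsprodE // (lie_bracketC z y) linearNr opprK.
Qed.

(** Left multiplication by [x] is minus the [w]-adjoint of [br x], that is, the coadjoint action
    carried over by [w]; it is a representation by Jacobi, which is [E]. *)
Lemma lsprod_left_symmetric x y z :
  (x ** y) ** z - x ** (y ** z) = (y ** x) ** z - y ** (x ** z).
Proof.
have [[_ jacobi] _ _] := br_w_symplectic.
suff E : br x y ** z = x ** (y ** z) - y ** (x ** z).
  by apply: subr_interchange; rewrite -lsprodBl lsprod_commutator.
apply: (nondegenerate_inj w_nondeg) => u.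
rewrite linearBl /= !lsprodE // !opprK -linearBr /= -linearNr; congr (w z _).
have := jacobi x y u.
rewrite (lie_bracketC u (br x y)) (lie_bracketC u x) linearNr.
move/eqP; rewrite subr_eq0 => /eqP <-.
by rewrite opprD opprK addrC.
Qed.

Hypothesis lsprod_novikov : novikov (lsprod br w).

Lemma novikov_adjoint x y u : br (x ** y) u = br x (u ** y).
Proof.
apply: (nondegenerate_inj w_nondeg) => z.
rewrite skew_symmetricC [RHS]skew_symmetricC -!lsprodE //.
by rewrite lsprod_novikov lsprod_selfadjoint.
Qed.

Lemma lsprodA x y z : x ** (y ** z) = (x ** y) ** z.
Proof.
have := novikov_adjoint x z y; rewrite -!lsprod_commutator.
(* For associators, [E] reads (x,y,z) = -(y,x,z), while [LS] reads (x,y,z) = (y,x,z). *)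
rewrite (lsprod_novikov x z y) (lsprod_novikov y z x) => /subr_interchange E.
have LS := lsprod_left_symmetric x y z.
apply/eqP; rewrite eq_sym -subr_eq0.
suff: ((x ** y) ** z - x ** (y ** z)) *+ 2 == 0.
  by rewrite -scaler_nat scaler_eq0 pnatr_eq0.
by rewrite mulr2n {1}LS E addrC subrKA subrr.
Qed.

Lemma lsprod_bracket x y z : x ** br y z = 0.
Proof.
by rewrite -lsprod_commutator lsprodBr !lsprodA lsprod_novikov subrr.
Qed.

End LeftSymmetricProduct.

Theorem corollary1 (R : realType) (g : vectType R)
    (br : {bilinear g -> g -> g}) (w : {skew_symmetric g}) :
  SNLA br w ->
  forall x y z t : g, br (br x y) (br z t) = 0.
Proof.
move=> [sympl nov] x y z t.
by rewrite -(lsprod_commutator _ _ _ _ sympl) !(lsprod_bracket _ _ _ _ sympl nov) subrr.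
Qed.
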